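(* Let $K$ and $m$ be fixed and let $n$ be arbitrary. Suppose the usage-rate reduction parameters satisfy $\eta_1\le\cdots\le\eta_K=\eta_{K+1}=\cdots=\eta_n$. Then both the total-energy platooning problem (minimize $\sum_{j=1}^nU_j$) and the min-max-energy platooning problem (minimize $\max_{1\le j\le n}U_j$), with $n$ vehicles, $m$ road segments and general vehicle parameters, can be solved in $O(mn^{Km+1})$ time.
   Context: Setting. There are $n$ vehicles and $m$ road segments with lengths $D_1,\ldots,D_m>0$. Vehicle $j$ has battery capacity $C_j>0$, usage rate $\delta_j>0$, initial state of charge $S_{j1}\in[0,1]$, and minimum allowable state of charge $\beta_j$ with $0\le\beta_j<S_{j1}$. Platoon positions have usage-rate reductions $0\le\eta_1\le\cdots\le\eta_n<1$. A solution specifies for each segment $i$ a permutation of the positions; $j_i$ is the position of vehicle $j$ in segment $i$. The total energy usage of vehicle $j$ is $U_j=\delta_j\sum_{i=1}^mD_i(1-\eta_{j_i})$, and a solution is feasible if $S_{j1}-U_j/C_j\ge\beta_j$ for all $j$. The minimizations are over feasible solutions; solving a problem means finding an optimal solution or determining that no feasible solution exists. Running time counts elementary arithmetic operations and comparisons. *)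

(* Defs.v *)
From mathcomp Require Import all_boot all_order all_algebra perm.

Set Implicit Arguments.
Unset Strict Implicit.
Unset Printing Implicit Defensive.

Import Order.TTheory GRing.Theory Num.Theory.

Local Open Scope ring_scope.

(** * The platooning problems *)

Record instance (R : realFieldType) (n m : nat) := Instance {
  len : 'I_m -> R;      (* D_i: segment lengths *)
  cap : 'I_n -> R;      (* C_j: battery capacities *)
  rate : 'I_n -> R;     (* delta_j: usage rates *)
  soc : 'I_n -> R;      (* S_j1: initial states of charge *)
  minsoc : 'I_n -> R;   (* beta_j: minimum allowable states of charge *)
  red : 'I_n -> R       (* eta: usage-rate reductions, indexed by position *)
}.

Section Platooning.
Variables (R : realFieldType) (n m : nat).
Implicit Type I : instance R n m.

Definition valid I : Prop :=
  [/\ forall i, 0 < len I i,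
      forall j, [/\ 0 < cap I j, 0 < rate I j, 0 <= soc I j <= 1
                  & 0 <= minsoc I j < soc I j],
      forall k, 0 <= red I k < 1
    & forall k l : 'I_n, (k <= l)%N -> red I k <= red I l].

(* eta_K = ... = eta_n; ordinals count from 0, so the K-th position is the
   ordinal of value K - 1. *)
Definition constant_from (K : nat) I : Prop :=
  forall k l : 'I_n, (K <= k.+1)%N -> (K <= l.+1)%N -> red I k = red I l.

(* sigma i j is the position of vehicle j in segment i. *)
Definition solution := 'I_m -> {perm 'I_n}.

Definition energy I (sigma : solution) (j : 'I_n) : R :=
  rate I j * (\sum_(i < m) len I i * (1 - red I (sigma i j))).

Definition feasible I (sigma : solution) : Prop :=
  forall j, minsoc I j <= soc I j - energy I sigma j / cap I j.

Definition total_energy I (sigma : solution) : R :=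
  \sum_(j < n) energy I sigma j.

(* On valid instances every energy is nonnegative, so starting the maximum
   from 0 does not affect it when 0 < n. *)
Definition max_energy I (sigma : solution) : R :=
  \big[Num.max/0]_(j < n) energy I sigma j.

Definition optimal (obj : instance R n m -> solution -> R) I
    (sigma : solution) : Prop :=
  feasible I sigma /\ forall tau, feasible I tau -> obj I sigma <= obj I tau.

End Platooning.

(** * A unit-cost real RAM

   Programs manipulate finitely many named arrays of natural numbers and,
   separately, of reals; all arrays are infinite, and a scalar variable is an
   array used at index 0 only.  Programs are finite syntax in which neither the
   field nor the number of vehicles occurs.  Natural numbers, which serve as
   indices and counters, can only be added, subtracted (with truncation) and
   compared; reals can be added, subtracted, multiplied, divided (with
   x / 0 = 0) and compared.  The only flow of information from reals to natural
   numbers is through comparisons; in particular there is no rounding. *)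

Inductive nexp :=
  | NConst of nat
  | NGet of nat & nexp            (* array name, index *)
  | NAdd of nexp & nexp
  | NSub of nexp & nexp.

Inductive rexp :=
  | RConst of nat
  | RGet of nat & nexp
  | RAdd of rexp & rexp
  | RSub of rexp & rexp
  | RMul of rexp & rexp
  | RDiv of rexp & rexp.

Inductive bexp :=
  | NLe of nexp & nexp
  | RLe of rexp & rexp
  | BNot of bexp
  | BAnd of bexp & bexp.

Inductive cmd :=
  | Skip
  | NPut of nat & nexp & nexp     (* array name, index, value *)
  | RPut of nat & nexp & rexp
  | Seq of cmd & cmd
  | If of bexp & cmd & cmd
  | While of bexp & cmd.

(* The cost of an expression counts every constant, memory access, arithmetic
   operation, comparison and connective. *)

Fixpoint ncost (e : nexp) : nat :=
  match e with
  | NConst _ => 1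
  | NGet _ e => (ncost e).+1
  | NAdd e f | NSub e f => (ncost e + ncost f).+1
  end.

Fixpoint rcost (e : rexp) : nat :=
  match e with
  | RConst _ => 1
  | RGet _ e => (ncost e).+1
  | RAdd e f | RSub e f | RMul e f | RDiv e f => (rcost e + rcost f).+1
  end.

Fixpoint bcost (b : bexp) : nat :=
  match b with
  | NLe e f => (ncost e + ncost f).+1
  | RLe e f => (rcost e + rcost f).+1
  | BNot b => (bcost b).+1
  | BAnd b c => (bcost b + bcost c).+1
  end.

(* mem a k is the content of cell k of array a. *)
Definition memory (T : Type) := nat -> nat -> T.

Definition put T (mem : memory T) (a k : nat) (v : T) : memory T :=
  fun b l => if (b == a) && (l == k) then v else mem b l.

Record state (R : Type) := State { nmem : memory nat; rmem : memory R }.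

Section Semantics.
Variable R : realFieldType.
Implicit Type s : state R.

Fixpoint neval s (e : nexp) : nat :=
  match e with
  | NConst k => k
  | NGet a e => nmem s a (neval s e)
  | NAdd e f => (neval s e + neval s f)%N
  | NSub e f => (neval s e - neval s f)%N
  end.

Fixpoint reval s (e : rexp) : R :=
  match e with
  | RConst k => k%:R
  | RGet a e => rmem s a (neval s e)
  | RAdd e f => reval s e + reval s f
  | RSub e f => reval s e - reval s f
  | RMul e f => reval s e * reval s f
  | RDiv e f => reval s e / reval s f
  end.

Fixpoint beval s (b : bexp) : bool :=
  match b with
  | NLe e f => (neval s e <= neval s f)%N
  | RLe e f => reval s e <= reval s f
  | BNot b => ~~ beval s b
  | BAnd b c => beval s b && beval s c
  end.

(* exec c s t s': started in state s, command c halts in state s' after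
   exactly t elementary operations. *)
Inductive exec : cmd -> state R -> nat -> state R -> Prop :=
  | ExecSkip s : exec Skip s 1 s
  | ExecNPut s a e f :
      exec (NPut a e f) s (ncost e + ncost f).+1
        (State (put (nmem s) a (neval s e) (neval s f)) (rmem s))
  | ExecRPut s a e f :
      exec (RPut a e f) s (ncost e + rcost f).+1
        (State (nmem s) (put (rmem s) a (neval s e) (reval s f)))
  | ExecSeq c d s s1 s2 t u of exec c s t s1 & exec d s1 u s2 :
      exec (Seq c d) s (t + u) s2
  | ExecIfTrue b c d s s1 t of beval s b & exec c s t s1 :
      exec (If b c d) s (bcost b + t) s1
  | ExecIfFalse b c d s s1 t of ~~ beval s b & exec d s t s1 :
      exec (If b c d) s (bcost b + t) s1
  | ExecWhileTrue b c s s1 s2 t u of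
      beval s b & exec c s t s1 & exec (While b c) s1 u s2 :
      exec (While b c) s (bcost b + t + u) s2
  | ExecWhileFalse b c s of ~~ beval s b :
      exec (While b c) s (bcost b) s.

Lemma exec_det c s t s1 u s2 :
  exec c s t s1 -> exec c s u s2 -> t = u /\ s1 = s2.
Proof.
move=> E; elim: E u s2 => {c s t s1}.
- by move=> s u s2 F; inversion F.
- by move=> s a e f u s2 F; inversion F.
- by move=> s a e f u s2 F; inversion F.
- move=> c d s s1 s2 t u _ IHc _ IHd u' s' F.
  inversion F as [| | |? ? ? ? ? ? ? Fc Fd| | | |]; subst.
  have [<- E1] := IHc _ _ Fc; subst.
  by have [<- <-] := IHd _ _ Fd.
- move=> b c d s s1 t Hb _ IH u s2 F.
  inversion F as [| | | |? ? ? ? ? ? Gb Fc|? ? ? ? ? ? Gb Fd| |]; subst.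
    by have [<- <-] := IH _ _ Fc.
  by rewrite Hb in Gb.
- move=> b c d s s1 t Hb _ IH u s2 F.
  inversion F as [| | | |? ? ? ? ? ? Gb Fc|? ? ? ? ? ? Gb Fd| |]; subst.
    by rewrite Gb in Hb.
  by have [<- <-] := IH _ _ Fd.
- move=> b c s s1 s2 t u Hb _ IHc _ IHw u' s' F.
  inversion F as [| | | | | |? ? ? ? ? ? ? Gb Fc Fw|? ? ? Gb]; subst.
    have [<- E1] := IHc _ _ Fc; subst.
    by have [<- <-] := IHw _ _ Fw.
  by rewrite Hb in Gb.
- move=> b c s Hb u s2 F.
  inversion F as [| | | | | |? ? ? ? ? ? ? Gb Fc Fw|]; subst => //.
  by rewrite Gb in Hb.
Qed.

End Semantics.

(** * Input, output and running time *)

Section Solving.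
Variables (R : realFieldType) (m : nat).

(* The array holding f 0, ..., f (p - 1), followed by zeros. *)
Definition load p (f : 'I_p -> R) (k : nat) : R :=
  oapp f 0 (insub k : option 'I_p).

(* Cells 0 and 1 of the array 0 of natural numbers hold n and m; the real
   arrays 0 to 5 hold D, C, delta, S, beta and eta. *)
Definition init n (I : instance R n m) : state R :=
  State
    (fun a k => if a == 0 then nth 0 [:: n; m] k else 0)%N
    (fun a k => nth 0 [:: load (len I) k; load (cap I) k; load (rate I) k;
                          load (soc I) k; load (minsoc I) k; load (red I) k] a).

(* Cell 0 of the array 1 of natural numbers holds 0 if the program reports that
   no feasible solution exists; otherwise cell i * n + j of the array 2 holds
   the position, counted from 0, of vehicle j in segment i. *)
Definition correct_output n (obj : instance R n m -> solution n m -> R)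
    (I : instance R n m) (s : state R) : Prop :=
  if nmem s 1%N 0%N == 0%N then forall sigma, ~ feasible I sigma
  else exists2 sigma : solution n m, optimal obj I sigma
       & forall (i : 'I_m) (j : 'I_n), nmem s 2%N (i * n + j)%N = sigma i j.

(* One program, and one constant in the O, for all numbers of vehicles and all
   admissible instances. *)
Definition solvable_in_bigO
    (obj : forall n, instance R n m -> solution n m -> R)
    (admissible : forall n, instance R n m -> Prop) (T : nat -> nat) : Prop :=
  exists (P : cmd) (c : nat), forall n (I : instance R n m), admissible n I ->
    exists t s, [/\ exec P (init I) t s, (t <= c * T n)%N
                  & correct_output (obj n) I s].

End Solving.

(* Main.v *)
(* There are at most [n ^ ((K - 1) * m)] ways to choose who occupies the first
   [K - 1] positions of every segment.  As all the later positions have the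
   same reduction, this choice determines every energy, so it can be evaluated
   in time O(n), and when it improves on the best choice met so far it can be
   completed to a full solution in time O(n) by placing the other vehicles in
   increasing order.  As [K] and [m] are fixed, all the choices can be
   enumerated by a fixed nest of [(K - 1) * m] loops. *)

Require Import Defs.
From mathcomp Require Import all_boot all_order all_algebra.
From mathcomp Require Import fingroup perm zify.

Set Implicit Arguments.
Unset Strict Implicit.
Unset Printing Implicit Defensive.

Import Order.TTheory GRing.Theory Num.Theory.

Local Open Scope ring_scope.

(** * Reasoning about programs *)

(** Syntactic over-approximation of the arrays of naturals that a command writes; together with
    [rwr] it supplies the frame conditions used throughout. *)
Fixpoint nwr (c : cmd) (a : nat) : bool :=
  match c with
  | NPut b _ _ => a == b
  | Seq c d | If _ c d => nwr c a || nwr d a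
  | While _ c => nwr c a
  | _ => false
  end.

Fixpoint rwr (c : cmd) (a : nat) : bool :=
  match c with
  | RPut b _ _ => a == b
  | Seq c d | If _ c d => rwr c a || rwr d a
  | While _ c => rwr c a
  | _ => false
  end.

Fixpoint depth (c : cmd) : nat :=
  match c with
  | Seq c d | If _ c d => maxn (depth c) (depth d)
  | While _ c => (depth c).+1
  | _ => 0
  end.

(* An upper bound on the running time when every loop makes [n] iterations. *)
Fixpoint tcost (n : nat) (c : cmd) : nat :=
  match c with
  | Skip => 1
  | NPut _ e f => (ncost e + ncost f).+1
  | RPut _ e f => (ncost e + rcost f).+1
  | Seq c d => tcost n c + tcost n d
  | If b c d => bcost b + (tcost n c + tcost n d)
  | While b c => n * (bcost b + tcost n c) + bcost b
  end.

(** Each loop raises the exponent by one. As [n > 0] makes every power of [n] at least 1, the costs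
    of guards and the lower powers are absorbed into the constant. *)
Lemma tcost_bound c :
  exists C, forall n, (0 < n)%N -> (tcost n c <= C * n ^ depth c)%N.
Proof.
have mono n C d1 d2 : (0 < n -> d1 <= d2 -> C * n ^ d1 <= C * n ^ d2)%N.
  by move=> n_gt0 le_d; rewrite leq_mul2l leq_pexp2l ?orbT.
elim: c => /=.
- by exists 1%N => n _; rewrite expn0.
- by move=> a e f; exists (ncost e + ncost f).+1 => n _; rewrite expn0 muln1.
- by move=> a e f; exists (ncost e + rcost f).+1 => n _; rewrite expn0 muln1.
- move=> c [C HC] d [D HD]; exists (C + D)%N => n n_gt0; rewrite mulnDl.
  apply: leq_add.
    by apply: leq_trans (HC n n_gt0) _; apply: mono => //; apply: leq_maxl.
  by apply: leq_trans (HD n n_gt0) _; apply: mono => //; apply: leq_maxr.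
- move=> b c [C HC] d [D HD]; exists (bcost b + (C + D))%N => n n_gt0.
  rewrite !mulnDl; apply: leq_add; first by rewrite leq_pmulr // expn_gt0 n_gt0.
  apply: leq_add.
    by apply: leq_trans (HC n n_gt0) _; apply: mono => //; apply: leq_maxl.
  by apply: leq_trans (HD n n_gt0) _; apply: mono => //; apply: leq_maxr.
- move=> b c [C HC]; exists (bcost b + C + bcost b)%N => n n_gt0.
  rewrite mulnDl; apply: leq_add; last by rewrite leq_pmulr // expn_gt0 n_gt0.
  rewrite expnS mulnCA leq_mul2l; apply/orP; right.
  rewrite mulnDl; apply: leq_add (HC n n_gt0).
  by rewrite leq_pmulr // expn_gt0 n_gt0.
Qed.

(** * Hoare-style rules with time bounds *)

Definition nput (R : Type) (s : state R) a k v : state R :=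
  State (put (nmem s) a k v) (rmem s).

Definition rput (R : Type) (s : state R) a k v : state R :=
  State (nmem s) (put (rmem s) a k v).

Local Notation nv a := (NGet a (NConst 0)).
Local Notation nset a e := (NPut a (NConst 0) e).
Local Notation rv a := (RGet a (NConst 0)).
Local Notation rset a e := (RPut a (NConst 0) e).

(* Cell 0 of the array 0 holds the number of iterations. *)
Definition loop (a : nat) (body : cmd) : cmd :=
  Seq (nset a (NConst 0))
    (While (NLe (NAdd (nv a) (NConst 1)) (nv 0))
       (Seq body (nset a (NAdd (nv a) (NConst 1))))).

Section Runs.
Variable R : realFieldType.
Implicit Types (s : state R) (Q : state R -> Prop) (c d : cmd) (n a : nat).

Definition frame c s s' : Prop :=
  (forall a k, ~~ nwr c a -> nmem s' a k = nmem s a k) /\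
  (forall a k, ~~ rwr c a -> rmem s' a k = rmem s a k).

Lemma exec_frame c s t s' : exec c s t s' -> frame c s s'.
Proof.
elim=> {c s t s'}; rewrite /frame /=.
- by [].
- by move=> s a e f; split=> b k //= /negbTE E; rewrite /put E.
- by move=> s a e f; split=> b k //= /negbTE E; rewrite /put E.
- move=> c d s s1 s2 t u _ [N1 R1] _ [N2 R2]; split=> a k; rewrite negb_or.
    by case/andP=> Hc Hd; rewrite N2 ?N1.
  by case/andP=> Hc Hd; rewrite R2 ?R1.
- by move=> b c d s s1 t _ _ [N1 R1]; split=> a k; rewrite negb_or => /andP[*];
    [rewrite N1 | rewrite R1].
- by move=> b c d s s1 t _ _ [N1 R1]; split=> a k; rewrite negb_or => /andP[*];
    [rewrite N1 | rewrite R1].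
- move=> b c s s1 s2 t u _ _ [N1 R1] _ [N2 R2].
  by split=> a k H; [rewrite N2 ?N1 | rewrite R2 ?R1].
- by [].
Qed.

(** The bound [tcost n c] is computed from the syntax, so the proofs built on the rules below never
    handle costs. *)
Definition runs n c s Q : Prop :=
  exists t s', [/\ exec c s t s', (t <= tcost n c)%N & Q s'].

Lemma runs_conseq n c s Q Q' :
  runs n c s Q -> (forall s', frame c s s' -> Q s' -> Q' s') -> runs n c s Q'.
Proof.
move=> [t [s' [E T Qs']]] QQ'; exists t, s'; split=> //.
by apply: QQ' Qs'; apply: exec_frame E.
Qed.

Lemma runs_skip n s Q : Q s -> runs n Skip s Q.
Proof. by exists 1%N, s; split=> //; constructor. Qed.

Lemma runs_nput n s a e f Q :
  Q (nput s a (neval s e) (neval s f)) -> runs n (NPut a e f) s Q.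
Proof. by move=> H; do 2!eexists; split; [constructor | | exact: H]. Qed.

Lemma runs_rput n s a e f Q :
  Q (rput s a (neval s e) (reval s f)) -> runs n (RPut a e f) s Q.
Proof. by move=> H; do 2!eexists; split; [constructor | | exact: H]. Qed.

Lemma runs_seq n s c d Q :
  runs n c s (fun s1 => runs n d s1 Q) -> runs n (Seq c d) s Q.
Proof.
move=> [t [s1 [E1 T1 [u [s2 [E2 T2 Qs2]]]]]].
exists (t + u)%N, s2; split=> //; first exact: ExecSeq E1 E2.
exact: leq_add.
Qed.

Lemma runs_if n s b c d Q :
    (beval s b -> runs n c s Q) -> (~~ beval s b -> runs n d s Q) ->
  runs n (If b c d) s Q.
Proof.
move=> Hc Hd; have [/[dup] Hb /Hc | /[dup] Hb /Hd] := boolP (beval s b).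
  move=> [t [s1 [E T Qs1]]]; exists (bcost b + t)%N, s1; split=> //.
    exact: ExecIfTrue.
  by rewrite /= leq_add2l (leq_trans T) // leq_addr.
move=> [t [s1 [E T Qs1]]]; exists (bcost b + t)%N, s1; split=> //.
  exact: ExecIfFalse.
by rewrite /= leq_add2l (leq_trans T) // leq_addl.
Qed.

(** The body writes neither the counter nor the bound in array 0, so exactly [n] iterations take
    place. The invariant is restored only once the counter is incremented, hence the [nput]. *)
Lemma runs_loop n a body s (Inv : nat -> state R -> Prop) :
    a != 0%N -> ~~ nwr body a -> ~~ nwr body 0 -> nmem s 0%N 0%N = n ->
    Inv 0%N (nput s a 0%N 0%N) ->
    (forall k s1, (k < n)%N -> frame (loop a body) s s1 ->
       nmem s1 a 0%N = k -> Inv k s1 ->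
       runs n body s1 (fun s2 => Inv k.+1 (nput s2 a 0%N k.+1))) ->
  runs n (loop a body) s (Inv n).
Proof.
move=> a_neq0 body_a body_0 s_n Inv0 InvS.
apply/runs_seq/runs_nput => /=.
set b := NLe _ _; set w := Seq body _.
have F0 : frame (loop a body) s (nput s a 0%N 0%N).
  by split=> c k //=; rewrite negb_or /put => /andP[/negbTE-> _].
have s0_a : nmem (nput s a 0%N 0%N) a 0%N = 0%N by rewrite /= /put !eqxx.
(* The counter goes up, so the induction is on the number [r] of remaining iterations. *)
suff: forall r k s1, (k + r = n)%N -> nmem s1 a 0%N = k ->
    frame (loop a body) s s1 -> Inv k s1 ->
    exists t s', [/\ exec (While b w) s1 t s',
      (t <= r * (bcost b + tcost n w) + bcost b)%N & Inv n s'].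
  by move/(_ n 0%N _ (add0n n) s0_a F0 Inv0).
elim=> [|r IHr] k s1 Ekr s1_a F Invk.
  exists (bcost b), s1; split=> //; last by rewrite -Ekr addn0.
  apply: ExecWhileFalse; rewrite /= s1_a.
  rewrite (proj1 F 0%N) ?s_n; first by rewrite -Ekr addn0 addn1 ltnn.
  by rewrite /= eq_sym (negbTE a_neq0) (negbTE body_0).
have lt_kn : (k < n)%N by rewrite -Ekr -addSnnS leq_addr.
have [t [s2 [E2 T2 Inv2]]] := InvS k s1 lt_kn F s1_a Invk.
have F2 := exec_frame E2.
have s2_a : nmem s2 a 0%N = k by rewrite (proj1 F2).
set s3 := nput s2 a 0%N k.+1 in Inv2.
(* 6 is the cost of the assignment that increments the counter. *)
have E3 : exec w s1 (t + 6) s3.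
  have -> : s3 = nput s2 a 0%N (nmem s2 a 0%N + 1)%N by rewrite s2_a addn1.
  apply: ExecSeq E2 _; exact: ExecNPut.
have F3 : frame (loop a body) s s3.
  split=> c l /=; rewrite ?orbF => H.
    have /norP[/negbTE ca /norP[Hb _]] := H.
    by rewrite /put ca /= (proj1 F2) // (proj1 F) //= negb_or ca.
  by rewrite (proj2 F2) // (proj2 F) //= orbF.
have [u [s' [E' T' I']]] : exists t s', [/\ exec (While b w) s3 t s',
    (t <= r * (bcost b + tcost n w) + bcost b)%N & Inv n s'].
  by apply: (IHr k.+1) => //; rewrite ?addSnnS //= /put !eqxx.
exists (bcost b + (t + 6) + u)%N, s'; split=> //.
  apply: ExecWhileTrue E3 E' => /=.
  rewrite s1_a (proj1 F 0%N) ?s_n ?addn1 //.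
  by rewrite /= eq_sym (negbTE a_neq0) (negbTE body_0).
have Tw : (t + 6 <= tcost n w)%N by apply: leq_add T2 (leqnn 6).
by lia.
Qed.

End Runs.

(** * Leaders determine the energies *)

Lemma load_ord (R : realFieldType) n (f : 'I_n -> R) (i : 'I_n) :
  load f i = f i.
Proof. by rewrite /load valK. Qed.

(* The position of vehicle [j] when the vehicles of [ds] come first, followed by
   the others in increasing order. *)
Definition place (ds : seq nat) (j : nat) : nat :=
  if j \in ds then index j ds
  else (size ds + count (fun x => x \notin ds) (iota 0 j))%N.

Lemma place_index ds n j : (j < n)%N ->
  place ds j = index j (ds ++ [seq x <- iota 0 n | x \notin ds]).
Proof.
move=> lt_jn; rewrite /place index_cat; case: ifPn => // j_ds; congr (_ + _)%N.
have -> : iota 0 n = iota 0 j ++ j :: iota j.+1 (n - j.+1).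
  by rewrite -{1}(subnKC (ltnW lt_jn)) iotaD -(subnSK lt_jn).
by rewrite filter_cat index_cat mem_filter mem_iota add0n ltnn andbF /= j_ds
  /= eqxx addn0 size_filter.
Qed.

(** The list [full] enumerates the numbers below [n] without repetition, so the index in it is an
    injective self-map of ['I_n], hence a permutation. *)
Lemma place_perm n ds : uniq ds -> {in ds, forall x, x < n}%N ->
  exists s : {perm 'I_n}, forall j : 'I_n, s j = place ds j :> nat.
Proof.
move=> ds_uniq ds_lt; set full := ds ++ [seq x <- iota 0 n | x \notin ds].
have mem_full x : (x \in full) = (x < n)%N.
  rewrite mem_cat mem_filter mem_iota /= add0n.
  by have [/ds_lt->|] := boolP (x \in ds).
have full_uniq : uniq full.
  rewrite cat_uniq ds_uniq filter_uniq ?iota_uniq // andbT /=.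
  by apply/hasPn=> x; rewrite mem_filter => /andP[].
have size_full : size full = n.
  rewrite -[RHS](size_iota 0); apply: perm_size; rewrite uniq_perm ?iota_uniq //.
  by move=> x; rewrite mem_full mem_iota.
have lt_place (j : 'I_n) : (place ds j < n)%N.
  by rewrite (place_index ds (ltn_ord j)) -/full -[X in (_ < X)%N]size_full
    index_mem mem_full.
have inj : injective (fun j => Ordinal (lt_place j)).
  move=> j1 j2 /(congr1 val) /=; rewrite !(@place_index ds n) // => /eqP E.
  apply: val_inj => /=.
  by rewrite -[LHS](@nth_index _ 0%N _ full) ?mem_full // (eqP E) nth_index ?mem_full.
by exists (perm inj) => j; rewrite permE.
Qed.

Definition seg (L : nat) (f : nat -> nat) (i : nat) : seq nat :=
  [seq f c | c <- iota (i * L) L].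

Section Leaders.
Variables (R : realFieldType) (n m L : nat).
Hypothesis lt_Ln : (L < n)%N.
Implicit Types (I : instance R n m) (f : nat -> nat) (tau : solution n m).

(* The digit [f (i * L + k)] is the vehicle at position [k] of segment [i]. *)
Definition leads f tau : Prop :=
  forall i j, (tau i j < L)%N -> f (i * L + tau i j)%N = j.

Lemma leads_ext f g tau :
  (forall c, (c < m * L)%N -> f c = g c) -> leads f tau -> leads g tau.
Proof.
move=> fg lead i j tau_lt; rewrite -fg ?lead //.
apply: leq_trans (_ : i.+1 * L <= _)%N; first by rewrite mulSn addnC ltn_add2r.
by rewrite leq_mul2r ltn_ord orbT.
Qed.

(** Digit [c] is decoded as position [c %% L] of segment [c %/ L], and the inverse permutation gives
    the occupant. The default 0 is a legal vehicle because [n > 0]. *)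
Lemma leads_exists tau :
  exists2 f, forall c, (f c < n)%N & leads f tau.
Proof.
have n_gt0 : (0 < n)%N by apply: leq_ltn_trans lt_Ln.
exists (fun c => if (insub (c %/ L)%N : option 'I_m, insub (c %% L)%N : option 'I_n)
                 is (Some i, Some k) then val ((tau i)^-1%g k) else 0%N).
  by move=> c; case: insub => [i|] //; case: insub => [k|] //=.
move=> i j tau_lt; have L_gt0 : (0 < L)%N by apply: leq_ltn_trans tau_lt.
by rewrite divnMDl // divn_small // addn0 modnMDl modn_small // !valK permK.
Qed.

Lemma nth_seg f i k : (k < L)%N -> nth 0%N (seg L f i) k = f (i * L + k)%N.
Proof. by move=> lt_k; rewrite (nth_map 0%N) ?size_iota // nth_iota. Qed.

Lemma size_seg f i : size (seg L f i) = L.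
Proof. by rewrite size_map size_iota. Qed.

(** Reading the permutation backwards exhibits the leaders as the image of an injective map, which
    gives their distinctness and decides membership. *)
Lemma seg_leads f tau (i : 'I_m) : leads f tau ->
  seg L f i =
  [seq val ((tau i)^-1%g (widen_ord (ltnW lt_Ln) k)) | k <- enum 'I_L].
Proof.
move=> lead; apply: (@eq_from_nth _ 0%N).
  by rewrite size_seg size_map size_enum_ord.
move=> k; rewrite size_seg => lt_k; rewrite nth_seg //.
pose k' := Ordinal lt_k.
rewrite (nth_map k') ?size_enum_ord //= (_ : nth _ _ _ = k'); last first.
  by apply: val_inj; rewrite /= nth_enum_ord.
rewrite -(lead i ((tau i)^-1%g (widen_ord (ltnW lt_Ln) k'))) permKV //=.
Qed.

Lemma seg_uniq f tau (i : 'I_m) : leads f tau -> uniq (seg L f i).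
Proof.
move/seg_leads->; rewrite map_inj_uniq ?enum_uniq //.
by move=> k l /val_inj /perm_inj /(congr1 val) /= /val_inj.
Qed.

(** A vehicle at position [L] or later is no leader, so [index] returns the length [L]; the [minn]
    records this default. *)
Lemma index_seg f tau (i : 'I_m) (j : 'I_n) : leads f tau ->
  index (nat_of_ord j) (seg L f i) = minn (tau i j) L.
Proof.
move=> lead; case: (ltnP (tau i j) L) => [lt_L|le_L].
  rewrite -{1}(lead i j lt_L) -nth_seg // index_uniq ?size_seg //.
  exact: seg_uniq lead.
rewrite -[RHS](size_seg f i); apply: memNindex.
rewrite (seg_leads _ lead); apply/mapP=> -[k _ /val_inj j_k].
by move: le_L; rewrite j_k permKV /= leqNgt ltn_ord.
Qed.

(** For a vehicle that is no leader [index] gives [L], which for [K = L + 1] is the first position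
    of the constant tail, counted from 0. The digits alone therefore determine the value. *)
Definition lead_energy I f (j : nat) : R :=
  load (rate I) j *
  \sum_(i < m) load (len I) i * (1 - load (red I) (index j (seg L f i))).

Lemma lead_energyE I f tau (j : 'I_n) : constant_from L.+1 I -> leads f tau ->
  energy I tau j = lead_energy I f j.
Proof.
move=> const lead; rewrite /energy /lead_energy load_ord; congr (_ * _).
apply: eq_bigr => i _; rewrite load_ord (index_seg _ _ lead); congr (_ * (1 - _)).
case: (ltnP (tau i j) L) => [lt_L|le_L]; first by rewrite load_ord.
by rewrite (const _ (Ordinal lt_Ln)) // -load_ord.
Qed.

(** [place] sends every vehicle that is no leader to position [L] or beyond, so the positions below
    [L] go to the prescribed leaders. *)
Lemma leads_place f : (forall i, (i < m)%N -> uniq (seg L f i)) ->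
    (forall c, (c < m * L)%N -> (f c < n)%N) ->
  exists2 tau, leads f tau &
    forall i j, tau i j = place (seg L f i) j :> nat.
Proof.
move=> f_uniq f_lt.
have /fin_all_exists[tau tauE] (i : 'I_m) : exists s : {perm 'I_n},
    forall j : 'I_n, s j = place (seg L f i) j :> nat.
  apply: place_perm; first exact: f_uniq.
  move=> x /mapP[c]; rewrite mem_iota => /andP[_ lt_c] ->; apply: f_lt.
  apply: leq_trans lt_c _; apply: leq_trans (_ : i.+1 * L <= _)%N.
    by rewrite mulSn addnC.
  by rewrite leq_mul2r ltn_ord orbT.
exists tau => // i j; rewrite tauE /place size_seg; case: ifPn => [j_f lt_L|_].
  by rewrite -nth_seg // nth_index.
by rewrite ltnNge leq_addr.
Qed.

End Leaders.

(** * The program *)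

Section Program.
Variables (m L : nat) (upd : cmd).

Definition eqB (a b : nat) : bexp := BAnd (NLe (nv a) (nv b)) (NLe (nv b) (nv a)).

Definition conj : seq bexp -> bexp := foldr BAnd (NLe (NConst 0) (NConst 0)).

(** Expanded over all pairs when the program is built, so the test contains no loop and has constant
    cost for fixed [K] and [m]. *)
Fixpoint uniqB (ds : seq nat) : bexp :=
  if ds is d :: ds' then
    BAnd (conj [seq BNot (eqB d d') | d' <- ds']) (uniqB ds')
  else NLe (NConst 0) (NConst 0).

(* The digit [c] is the scalar variable [8 + c]. *)
Definition digits (i : nat) : seq nat := [seq (8 + c)%N | c <- iota (i * L) L].

Definition distinctB : bexp := conj [seq uniqB (digits i) | i <- iota 0 m].

(* Variables: 4 is the current vehicle and 7 receives its position. *)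
Fixpoint look (ds : seq nat) (k : nat) : cmd :=
  if ds is d :: ds' then If (eqB d 4) (nset 7 (NConst k)) (look ds' k.+1)
  else nset 7 (NConst k).

Fixpoint effort (i : nat) : cmd :=
  if i is i'.+1 then
    Seq (effort i') (Seq (look (digits i') 0)
      (rset 6 (RAdd (rv 6) (RMul (RGet 0 (NConst i'))
                              (RSub (RConst 1) (RGet 5 (nv 7)))))))
  else rset 6 (RConst 0).

(* 5 is positive as long as no violation of feasibility was met; the reals 6
   and 7 are the energy of the current vehicle and the objective so far. *)
Definition eval : cmd :=
  Seq (nset 5 (NConst 1)) (Seq (rset 7 (RConst 0)) (loop 4
    (Seq (effort m) (Seq (rset 6 (RMul (RGet 2 (nv 4)) (rv 6))) (Seq upd
      (If (RLe (RGet 4 (nv 4))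
             (RSub (RGet 3 (nv 4)) (RDiv (rv 6) (RGet 1 (nv 4)))))
         Skip (nset 5 (NConst 0)))))))).

(* 3 is the next cell to write and 6 the next position that has no leader. *)
Fixpoint emit (i : nat) : cmd :=
  if i is i'.+1 then
    Seq (emit i') (Seq (nset 6 (NConst L)) (loop 4
      (Seq (look (digits i') 0)
      (Seq (If (NLe (NConst L) (nv 7))
              (Seq (NPut 2 (nv 3) (nv 6)) (nset 6 (NAdd (nv 6) (NConst 1))))
              (NPut 2 (nv 3) (nv 7)))
           (nset 3 (NAdd (nv 3) (NConst 1)))))))
  else nset 3 (NConst 0).

(* The real 8 is the best objective so far. *)
Definition try : cmd :=
  If distinctB
    (Seq eval
       (If (BAnd (NLe (NConst 1) (nv 5))
              (BNot (BAnd (NLe (NConst 1) (nv 1)) (RLe (rv 8) (rv 7)))))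
          (Seq (rset 8 (rv 7)) (Seq (nset 1 (NConst 1)) (emit m)))
          Skip))
    Skip.

(** The loop counters are themselves the digits: variable [8 + e] is both counter and digit [e], so
    [try] finds a complete choice in memory. *)
Fixpoint nest (e d : nat) : cmd :=
  if d is d'.+1 then loop (8 + e) (nest e.+1 d') else try.

(** * Write sets and loop depths of the program *)

Lemma nwr_look ds k a : nwr (look ds k) a = (a == 7%N).
Proof. by elim: ds k => [|d ds IH] k //=; rewrite IH orbb. Qed.

Lemma rwr_look ds k a : rwr (look ds k) a = false.
Proof. by elim: ds k => [|d ds IH] k //=; rewrite IH. Qed.

Lemma depth_look ds k : depth (look ds k) = 0%N.
Proof. by elim: ds k => [|d ds IH] k //=; rewrite IH. Qed.

Lemma nwr_effort i a : nwr (effort i) a -> a = 7%N.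
Proof. by elim: i => [|i IH] //=; rewrite nwr_look orbF => /orP[/IH|/eqP]. Qed.

Lemma rwr_effort i a : rwr (effort i) a -> a = 6%N.
Proof.
elim: i => [|i IH] /=; first by move/eqP.
by rewrite rwr_look => /orP[/IH|/eqP].
Qed.

Lemma depth_effort i : depth (effort i) = 0%N.
Proof. by elim: i => [|i IH] //=; rewrite IH depth_look. Qed.

Lemma nwr_emit i a : nwr (emit i) a -> a \in [:: 2; 3; 4; 6; 7]%N.
Proof.
elim: i => [|i IH] /=; first by move/eqP->.
by rewrite nwr_look !inE => /orP[/IH|]; rewrite ?inE //; lia.
Qed.

Lemma rwr_emit i a : rwr (emit i) a = false.
Proof. by elim: i => [|i IH] //=; rewrite IH rwr_look. Qed.

Lemma depth_emit i : (depth (emit i) <= 1)%N.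
Proof. by elim: i => [|i IH] //=; rewrite depth_look geq_max IH. Qed.

Hypothesis nwr_upd : forall a, nwr upd a = false.
Hypothesis rwr_upd : forall a, rwr upd a -> a = 7%N.

Lemma nwr_eval a : nwr eval a -> a \in [:: 4; 5; 7]%N.
Proof.
rewrite /= nwr_upd !inE; case E: (nwr _ _); last by lia.
by rewrite (nwr_effort E).
Qed.

Lemma rwr_eval a : rwr eval a -> a \in [:: 6; 7]%N.
Proof.
rewrite /= !inE; case E: (rwr (effort m) _); first by rewrite (rwr_effort E).
by have := @rwr_upd a; lia.
Qed.

Lemma nwr_try a : nwr try a -> (0 < a < 8)%N.
Proof.
rewrite [nwr _ _]/= -[X in [|| X, _ | _] || _]/(nwr eval a) orbF.
case/orP => [/nwr_eval|]; first by rewrite !inE; lia.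
by rewrite orbF => /orP[|/nwr_emit]; rewrite ?inE; lia.
Qed.

Lemma rwr_try a : rwr try a -> (6 <= a)%N.
Proof.
have -> : rwr try a = rwr eval a || ((a == 8%N) || rwr (emit m) a || false) || false.
  by [].
rewrite rwr_emit; case: (boolP (rwr eval a)) => [/rwr_eval|_]; rewrite ?inE; lia.
Qed.

(** The iteration bound and the outer counters survive an inner nest, as [runs_loop] demands of a
    loop body. *)
Lemma nwr_nest e d a : nwr (nest e d) a ->
  (0 < a < 8 + e + d)%N && ~~ (8 <= a < 8 + e)%N.
Proof.
elim: d e => [|d IH] e /=; first by move/nwr_try; lia.
case/or3P=> [|/IH|]; lia.
Qed.

Lemma rwr_nest e d a : rwr (nest e d) a -> (6 <= a)%N.
Proof. by elim: d e => [|d IH] e /=; [exact: rwr_try | rewrite orbF; exact: IH]. Qed.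

Hypothesis depth_upd : depth upd = 0%N.

(** Evaluation and output consist of loops in sequence, never nested, so treating one choice takes
    time linear in [n]. *)
Lemma depth_try : (depth try <= 1)%N.
Proof.
rewrite /= depth_effort depth_upd; have := depth_emit m; lia.
Qed.

Lemma depth_nest e d : (depth (nest e d) <= d.+1)%N.
Proof.
elim: d e => [|d IH] e /=; first exact: depth_try.
by have := IH e.+1; rewrite maxn0 max0n.
Qed.

End Program.

(** The initial value need not be neutral, as with 0 for [Num.max]; commutativity moves the last
    term to the front, where it can be split off. *)
Lemma big_ord_recr_com (R : Type) (op : SemiGroup.com_law R) (x : R)
    (F : nat -> R) n :
  \big[op/x]_(j < n.+1) F j = op (\big[op/x]_(j < n) F j) (F n).
Proof.
rewrite -!(big_mkord xpredT F) /index_iota !subn0 SemiGroup.Theory.mulmC.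
rewrite (perm_big (n :: iota 0 n)) ?big_cons //.
by rewrite -[in X in perm_eq X]addn1 iotaD add0n perm_sym -cat1s perm_catC.
Qed.

(** * Correctness of the program by loop invariants *)

Section Correctness.
Variables (R : realFieldType) (n m L : nat) (I : instance R n m).
Variables (op : SemiGroup.com_law R) (upd : cmd).
Hypothesis nwr_upd : forall a, nwr upd a = false.
Hypothesis rwr_upd : forall a, rwr upd a -> a = 7%N.
Hypothesis runs_upd : forall s : state R, runs n upd s
  (fun s' => rmem s' 7%N 0%N = op (rmem s 7%N 0%N) (rmem s 6%N 0%N)).
Hypothesis lt_Ln : (L < n)%N.
Hypothesis const : constant_from L.+1 I.
Implicit Types (s : state R) (f : nat -> nat) (tau sigma : solution n m).

Definition inputs s : Prop :=
  nmem s 0%N 0%N = n /\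
  [/\ rmem s 0%N =1 load (len I), rmem s 1%N =1 load (cap I),
      rmem s 2%N =1 load (rate I), rmem s 3%N =1 load (soc I)
    & rmem s 4%N =1 load (minsoc I) /\ rmem s 5%N =1 load (red I)].

Definition digit s (c : nat) : nat := nmem s (8 + c)%N 0%N.

Lemma inputs_frame c s s' : frame c s s' -> ~~ nwr c 0 ->
  (forall a, (a < 6)%N -> ~~ rwr c a) -> inputs s -> inputs s'.
Proof.
move=> [N F] n0 r6 [i [i0 i1 i2 i3 [i4 i5]]]; split; first by rewrite N.
by split=> [k|k|k|k|]; [..|split=> k]; rewrite F ?r6.
Qed.

Lemma digit_frame c s s' f : frame c s s' ->
  (forall a, (8 <= a)%N -> ~~ nwr c a) -> digit s =1 f -> digit s' =1 f.
Proof. by move=> [N _] n8 df k; rewrite -df /digit N ?n8 ?leq_addr. Qed.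

Lemma beval_eqB s a b : beval s (eqB a b) = (nmem s a 0%N == nmem s b 0%N).
Proof. by rewrite eqn_leq. Qed.

Lemma beval_conj s bs : beval s (conj bs) = all (beval s) bs.
Proof. by elim: bs => //= b bs ->. Qed.

Lemma beval_uniqB s ds : beval s (uniqB ds) = uniq [seq nmem s d 0%N | d <- ds].
Proof.
elim: ds => //= d ds ->; rewrite beval_conj all_map -has_pred1 has_map -all_predC.
by congr (_ && _); apply: eq_all => d' /=; rewrite -eqn_leq eq_sym.
Qed.

Lemma map_digits s f i : digit s =1 f ->
  [seq nmem s d 0%N | d <- digits L i] = seg L f i.
Proof. by move=> df; rewrite -map_comp; apply: eq_map. Qed.

Lemma beval_distinctB s f : digit s =1 f ->
  reflect (forall i, (i < m)%N -> uniq (seg L f i)) (beval s (distinctB m L)).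
Proof.
move=> df; rewrite beval_conj all_map; apply: (iffP allP) => H i.
  by move=> lt_im; rewrite -(map_digits _ df) -beval_uniqB; apply: H; rewrite mem_iota.
by rewrite mem_iota /= => lt_im; rewrite beval_uniqB (map_digits _ df) H.
Qed.

(** When no leader matches, the chain of tests ends with [k] plus the length of [ds], the same
    default as that of [index]. *)
Lemma runs_look s ds k : runs n (look ds k) s (fun s' =>
  nmem s' 7%N 0%N = k + index (nmem s 4%N 0%N) [seq nmem s d 0%N | d <- ds])%N.
Proof.
elim: ds k => [|d ds IH] k; first by apply: runs_nput; rewrite /= addn0.
apply: runs_if; rewrite beval_eqB /=.
  by move=> ->; apply: runs_nput; rewrite /= addn0.
move=> /negbTE->; apply: runs_conseq (IH k.+1) _ => s' _ ->.
by rewrite addSnnS.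
Qed.

Lemma runs_effort s f i : inputs s -> digit s =1 f ->
  runs n (effort L i) s (fun s' => rmem s' 6%N 0%N =
    \sum_(i' < i) load (len I) i' *
      (1 - load (red I) (index (nmem s 4%N 0%N) (seg L f i')))).
Proof.
move=> inp df; elim: i => [|i IH].
  by apply: runs_rput; rewrite /= big_ord0.
apply: runs_seq; apply: runs_conseq IH _ => s1 F1 acc.
have n1 a : a != 7%N -> ~~ nwr (effort L i) a.
  by apply: contraNN => /nwr_effort->.
apply: runs_seq; apply: runs_conseq (runs_look _ _ _) _ => s2 F2.
have df1 : digit s1 =1 f by apply: digit_frame F1 _ df => a ?; apply: n1; lia.
rewrite add0n (map_digits _ df1) (proj1 F1) ?n1 // => pos.
have inp2 : inputs s2.
  apply: (inputs_frame F2); rewrite ?nwr_look //; first by move=> a _; rewrite rwr_look.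
  apply: (inputs_frame F1); rewrite ?n1 // => a lt_a.
  by apply: contraTN lt_a => /rwr_effort->.
apply: runs_rput; case: inp2 => _ [len2 _ _ _ [_ red2]].
rewrite /= len2 red2 pos big_ord_recr /= -acc; congr (_ + _).
by rewrite (proj2 F2) ?rwr_look.
Qed.

Definition lead_ok f (j : nat) : bool :=
  load (minsoc I) j <= load (soc I) j - lead_energy L I f j / load (cap I) j.

Lemma runs_eval s f : inputs s -> digit s =1 f ->
  runs n (eval m L upd) s (fun s' =>
    rmem s' 7%N 0%N = \big[op/0]_(j < n) lead_energy L I f j /\
    (0 < nmem s' 5%N 0%N)%N = all (lead_ok f) (iota 0 n)).
Proof.
move=> inp df; apply/runs_seq/runs_nput/runs_seq/runs_rput => /=.
(* Variable 5 starts at 1 and can only drop to 0, so it records the conjunction of the feasibility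
   tests made so far. *)
pose Inv k s := rmem s 7%N 0%N = \big[op/0]_(j < k) lead_energy L I f j /\
    (0 < nmem s 5%N 0%N)%N = all (lead_ok f) (iota 0 k).
apply: (@runs_loop _ _ _ _ _ Inv) => //.
- by rewrite /= nwr_upd; apply/norP; split=> //; apply/negP => /nwr_effort.
- by rewrite /= nwr_upd; apply/norP; split=> //; apply/negP => /nwr_effort.
- by case: inp.
- by rewrite /Inv /= big_ord0.
move=> k s1 lt_kn F1 s1_k [obj1 ok1].
have inp1 : inputs s1.
  apply: (inputs_frame F1) inp => [|a lt_a] /=.
    by rewrite nwr_upd; apply/norP; split=> //; rewrite orbF; apply/negP => /nwr_effort.
  have := @rwr_effort L m a; have := @rwr_upd a; rewrite !orbF; lia.
have df1 : digit s1 =1 f.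
  apply: (digit_frame F1) df => a le_a /=; rewrite nwr_upd.
  have := @nwr_effort L m a; lia.
apply/runs_seq; apply: runs_conseq (runs_effort m inp1 df1) _ => s2 F2.
rewrite s1_k => acc2.
have n2 a : a != 7%N -> nmem s2 a 0%N = nmem s1 a 0%N.
  by move=> ne; rewrite (proj1 F2) //; apply: contraNN ne => /nwr_effort->.
have inp2 : inputs s2.
  apply: (inputs_frame F2) inp1 => [|a lt_a]; first by apply/negP => /nwr_effort.
  by apply: contraTN lt_a => /rwr_effort->.
have obj2 : rmem s2 7%N 0%N = rmem s1 7%N 0%N.
  by rewrite (proj2 F2) //; apply/negP => /rwr_effort.
apply/runs_seq/runs_rput/runs_seq => /=.
rewrite n2 // s1_k acc2; case: (inp2) => _ [_ _ -> _ _].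
rewrite -[X in rput _ _ _ X]/(lead_energy L I f k).
set s3 := rput _ _ _ _.
apply: runs_conseq (runs_upd s3) _ => s4 F4.
move=> obj4.
have n4 a : nmem s4 a 0%N = nmem s2 a 0%N by rewrite (proj1 F4) ?nwr_upd.
have r4 a l : (a < 6)%N -> rmem s4 a l = rmem s2 a l.
  move=> lt_a; rewrite (proj2 F4); last by have := @rwr_upd a; lia.
  by rewrite /= /put; case: eqP lt_a => // ->.
have e4 : rmem s4 6%N 0%N = lead_energy L I f k.
  by rewrite (proj2 F4) //; apply/negP => /rwr_upd.
have okE : lead_ok f k =
    beval s4 (RLe (RGet 4 (nv 4))
             (RSub (RGet 3 (nv 4)) (RDiv (rv 6) (RGet 1 (nv 4))))).
  case: inp2 => _ [_ c2 _ so2 [mi2 _]].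
  by rewrite /= e4 !r4 // !n4 !n2 // s1_k c2 so2 mi2.
have obj5 : rmem s4 7%N 0%N = \big[op/0]_(j < k.+1) lead_energy L I f j.
  by rewrite obj4 /= /put /= big_ord_recr_com -obj1 -obj2.
have all_k : all (lead_ok f) (iota 0 k.+1) = all (lead_ok f) (iota 0 k) && lead_ok f k.
  by rewrite -addn1 iotaD all_cat /= andbT.
apply: runs_if => Hb.
  apply: runs_skip; split=> //.
  by rewrite all_k okE Hb andbT -ok1 /= /put /= n4 n2.
apply: runs_nput; split=> //.
by rewrite all_k okE (negbTE Hb) andbF.
Qed.

Lemma runs_emit s f i : inputs s -> digit s =1 f ->
  runs n (emit L i) s (fun s' => nmem s' 3%N 0%N = (i * n)%N /\
    forall i' j, (j < n)%N -> (i' * n + j < i * n)%N ->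
      nmem s' 2%N (i' * n + j)%N = place (seg L f i') j).
Proof.
move=> inp df; elim: i => [|i IH]; first by apply: runs_nput; split.
apply: runs_seq; apply: runs_conseq IH _ => s1 F1 [b1 out1].
have n1 a : a \notin [:: 2; 3; 4; 6; 7]%N -> ~~ nwr (emit L i) a.
  by apply: contraNN => /nwr_emit.
have df1 : digit s1 =1 f.
  by apply: (digit_frame F1) df => a le_a; apply: n1; rewrite !inE; lia.
apply/runs_seq/runs_nput => /=; set s2 := nput _ _ _ _.
(* Variable 3 runs through the cells row by row; variable 6 holds the position that [place] assigns
   to the next vehicle that is no leader. *)
pose Inv k s := [/\ nmem s 3%N 0%N = (i * n + k)%N,
  nmem s 6%N 0%N = (L + count (fun x => x \notin seg L f i) (iota 0 k))%N
  & forall i' j, (j < n)%N -> (i' * n + j < i * n + k)%N ->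
      nmem s 2%N (i' * n + j)%N = place (seg L f i') j].
apply: (@runs_conseq _ _ _ _ (Inv n)); last first.
  by move=> s' _ [b _ out]; rewrite mulSn addnC.
have nwr_body a : a \notin [:: 2; 3; 6; 7]%N ->
    ~~ [|| nwr (look (digits L i) 0) a, (a == 2) || (a == 6) || (a == 2)
         | a == 3]%N.
  by rewrite nwr_look !inE; lia.
apply: runs_loop => //; try exact: nwr_body.
- by rewrite /s2 /= /put /= (proj1 F1) ?n1 //; case: inp.
- by split; rewrite /= ?addn0.
move=> k s3 lt_kn F3 s3_k [b3 c3 out3].
have df3 : digit s3 =1 f.
  apply: (digit_frame F3) df1 => a le_a /=.
  by have := nwr_body a; rewrite !inE; lia.
apply: runs_seq; apply: runs_conseq (runs_look _ _ _) _ => s4 F4.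
rewrite add0n (map_digits _ df3) s3_k => pos4.
have n4 a l : a != 7%N -> nmem s4 a l = nmem s3 a l.
  by move=> ne; rewrite (proj1 F4) ?nwr_look.
(* By uniqueness of quotient and remainder, the only cell newly covered by the invariant is the one
   written in this iteration. *)
have cell i' j : (j < n)%N -> (i' * n + j < i * n + k.+1)%N ->
    (i' * n + j < i * n + k)%N || ((i' == i) && (j == k)).
  move=> lt_jn; rewrite addnS ltnS leq_eqVlt orbC => /orP[->//|/eqP E].
  have n_gt0 : (0 < n)%N by apply: leq_ltn_trans lt_jn.
  have := congr1 (divn^~ n) E; rewrite /= !divnMDl // !divn_small // !addn0 => Ei.
  by move: E; rewrite Ei => /addnI->; rewrite !eqxx orbT.
have count_k : count (fun x => x \notin seg L f i) (iota 0 k.+1) =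
    (count (fun x => x \notin seg L f i) (iota 0 k) + (k \notin seg L f i))%N.
  by rewrite -addn1 iotaD count_cat /= addn0.
have mem_k : (L <= nmem s4 7%N 0%N)%N = (k \notin seg L f i).
  by rewrite pos4 -[X in (X <= _)%N](size_seg L f i) leqNgt index_mem.
apply/runs_seq/runs_if => /=; rewrite mem_k => k_seg.
  apply/runs_seq/runs_nput/runs_nput/runs_nput; split.
  - by rewrite /= /put /= !n4 // b3 addn1 addnS.
  - by rewrite count_k k_seg /= /put /= !n4 // c3 addnA.
  move=> i' j lt_jn lt_c; rewrite /= /put /= !n4 // b3 c3.
  have /orP[lt_c'|/andP[/eqP-> /eqP->]] := cell _ _ lt_jn lt_c.
    by rewrite ltn_eqF // out3.
  by rewrite eqxx /place (negbTE k_seg) size_seg.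
apply/runs_nput/runs_nput; split.
- by rewrite /= /put /= !n4 // b3 addn1 addnS.
- by rewrite count_k (negbTE k_seg) addn0 /= /put /= n4.
move=> i' j lt_jn lt_c; rewrite /= /put /= (n4 3%N) // (n4 2%N) // b3.
have /orP[lt_c'|/andP[/eqP-> /eqP->]] := cell _ _ lt_jn lt_c.
  by rewrite ltn_eqF // out3.
by rewrite eqxx /place (negbNE k_seg) pos4.
Qed.

Definition objective tau : R := \big[op/0]_(j < n) energy I tau j.

Lemma objectiveE f tau : leads L f tau ->
  objective tau = \big[op/0]_(j < n) lead_energy L I f j.
Proof. by move=> lead; apply: eq_bigr => j _; apply: lead_energyE. Qed.

Lemma feasibleP f tau : leads L f tau ->
  reflect (feasible I tau) (all (lead_ok f) (iota 0 n)).
Proof.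
move=> lead; apply: (iffP allP) => H j.
  have := H j; rewrite mem_iota /= add0n ltn_ord /lead_ok !load_ord => /(_ isT).
  by rewrite -(lead_energyE lt_Ln _ const lead).
rewrite mem_iota /= add0n => lt_j; have := H (Ordinal lt_j).
by rewrite (lead_energyE lt_Ln _ const lead) -!load_ord.
Qed.

(** Guarded by the flag in array 1, since the stored objective and solution are meaningless until a
    first feasible choice is found. *)
Definition solved s : Prop :=
  (0 < nmem s 1%N 0%N)%N ->
  exists2 sigma, feasible I sigma /\ rmem s 8%N 0%N = objective sigma
    & forall (i : 'I_m) (j : 'I_n), nmem s 2%N (i * n + j)%N = sigma i j.

(** Requiring the flag to be set for a feasible [tau] is what later justifies the report of
    infeasibility. *)
Definition beaten tau s : Prop :=
  feasible I tau -> (0 < nmem s 1%N 0%N)%N /\ rmem s 8%N 0%N <= objective tau.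

(** All solutions led by [f] have the same energies, so one evaluation settles them all. If two
    digits of a segment coincide, no solution is led by [f]. *)
Lemma runs_try s f : inputs s -> digit s =1 f ->
    (forall c, (c < m * L)%N -> (f c < n)%N) -> solved s ->
  runs n (try m L upd) s (fun s' =>
    [/\ solved s', forall tau, beaten tau s -> beaten tau s'
      & forall tau, leads L f tau -> beaten tau s']).
Proof.
move=> inp df f_lt sol; apply: runs_if => [/(beval_distinctB df)|] f_uniq; last first.
  apply: runs_skip; split=> // tau lead; case/(beval_distinctB df): f_uniq => i lt_im.
  exact: (seg_uniq lt_Ln (Ordinal lt_im) lead).
apply: runs_seq; apply: runs_conseq (runs_eval inp df) _ => s1 F1 [obj1 ok1].
have n1 a l : a \notin [:: 4; 5; 7]%N -> nmem s1 a l = nmem s a l.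
  by move=> a1; rewrite (proj1 F1) //; apply: contraNN a1 => /(nwr_eval nwr_upd).
have r1 : rmem s1 8%N 0%N = rmem s 8%N 0%N.
  by rewrite (proj2 F1) //; apply/negP => /(rwr_eval rwr_upd).
apply: runs_if => /= [/andP[ok new]|old].
  have inp1 : inputs s1.
    apply: (inputs_frame F1) inp => [|a lt_a].
      by apply/negP => /(nwr_eval nwr_upd).
    by apply: contraTN lt_a => /(rwr_eval rwr_upd); rewrite !inE; lia.
  have df1 : digit s1 =1 f by move=> c; rewrite -df /digit n1.
  apply/runs_seq/runs_rput/runs_seq/runs_nput => /=; set s2 := nput _ _ _ _.
  apply: runs_conseq (runs_emit m (inp1 : inputs s2) (df1 : digit s2 =1 f)) _.
  move=> s3 F3 [_ out3].
  have flag3 : nmem s3 1%N 0%N = 1%N.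
    by rewrite (proj1 F3) //; apply/negP => /nwr_emit.
  have best3 : rmem s3 8%N 0%N = \big[op/0]_(j < n) lead_energy L I f j.
    by rewrite (proj2 F3) ?rwr_emit // -obj1.
  split=> [_|tau|tau lead]; rewrite /beaten ?flag3 ?best3.
  - have [sigma lead sigmaE] := leads_place f_uniq f_lt.
    exists sigma.
      by split; [apply/(feasibleP lead); rewrite -ok1 | rewrite (objectiveE lead)].
    move=> i j; rewrite sigmaE out3 //.
    have : (i.+1 * n <= m * n)%N by rewrite leq_mul2r ltn_ord orbT.
    by rewrite mulSn; have := ltn_ord j; lia.
  (* Once the flag is set, only a strictly better choice replaces the incumbent, so what was beaten
     stays beaten. *)
  - move=> beat feas; split=> //; have [flag le_tau] := beat feas.
    apply: le_trans le_tau; move: new; rewrite n1 // flag /= -ltNge r1 obj1.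
    exact: ltW.
  - by rewrite (objectiveE lead).
have solbeat : [/\ nmem s1 1%N 0%N = nmem s 1%N 0%N, nmem s1 2%N =1 nmem s 2%N
   & rmem s1 8%N 0%N = rmem s 8%N 0%N] by split=> // [|k]; rewrite n1.
case: solbeat => flag out best.
apply: runs_skip; split=> [|tau|tau lead].
- rewrite /solved flag best => /sol[sigma ? sigmaE]; exists sigma => // i j.
  by rewrite out.
- by rewrite /beaten flag best.
(* A feasible choice is rejected only if there is an incumbent that is at least as good. *)
- move=> /(feasibleP lead) feas; rewrite (objectiveE lead) -obj1.
  by move: old; rewrite ok1 feas /= negbK => /andP.
Qed.

(** Quantifying over every [f] that agrees with the digits of the outer loops lets the induction on
    [d] cover all completions of the current prefix. *)
Lemma runs_nest e d s : (e + d = m * L)%N -> inputs s ->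
    (forall c, (c < e)%N -> (digit s c < n)%N) -> solved s ->
  runs n (nest m L upd e d) s (fun s' =>
    [/\ solved s', forall tau, beaten tau s -> beaten tau s'
      & forall f tau, (forall c, (c < e)%N -> f c = digit s c) ->
          (forall c, (c < m * L)%N -> (f c < n)%N) -> leads L f tau ->
          beaten tau s']).
Proof.
elim: d e s => [|d IH] e s ed inp s_lt sol.
  rewrite addn0 in ed; rewrite ed in s_lt *.
  apply: runs_conseq (runs_try inp (frefl _) s_lt sol) _ => s' _ [sol' mono new].
  split=> // f tau f_s f_lt lead; apply: new.
  exact: leads_ext f_s lead.
(* After [k] iterations the completions whose digit [e] is below [k] have been treated. *)
pose Inv k s1 := [/\ solved s1, forall tau, beaten tau s -> beaten tau s1
  & forall f tau, (forall c, (c < e)%N -> f c = digit s c) ->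
      (forall c, (c < m * L)%N -> (f c < n)%N) -> (f e < k)%N -> leads L f tau ->
      beaten tau s1].
apply: (@runs_conseq _ _ _ _ (Inv n)); last first.
  move=> s' _ [sol' mono new]; split=> // f tau f_s f_lt; apply: new => //.
  by apply: f_lt; rewrite -ed; lia.
have nwr_nest' a : nwr (nest m L upd e.+1 d) a ->
    (0 < a < 8)%N || (8 + e < a)%N.
  by move/(nwr_nest nwr_upd); lia.
rewrite -[nest _ _ _ _ _]/(loop (8 + e) (nest m L upd e.+1 d)).
apply: runs_loop => //.
- by apply/negP => /nwr_nest'; lia.
- by apply/negP => /nwr_nest'; lia.
- by case: inp.
move=> k s1 lt_kn F1 s1_k [sol1 mono1 new1].
have inp1 : inputs s1.
  apply: (inputs_frame F1) inp => [|a lt_a] /=.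
    by have := @nwr_nest' 0%N; lia.
  have := @rwr_nest m L _ rwr_upd e.+1 d a; lia.
have digit1 c : (c < e)%N -> digit s1 c = digit s c.
  move=> lt_c; rewrite /digit (proj1 F1) //=.
  by have := @nwr_nest' (8 + c)%N; lia.
have s1_lt c : (c < e.+1)%N -> (digit s1 c < n)%N.
  rewrite ltnS leq_eqVlt => /orP[/eqP->|lt_c]; first by rewrite /digit s1_k.
  by rewrite digit1 ?s_lt.
apply: runs_conseq (IH e.+1 s1 _ inp1 s1_lt sol1) _; first by rewrite addSnnS.
move=> s2 F2 [sol2 mono2 new2]; split=> [|tau /mono1/mono2|f tau f_s f_lt] //.
(* The value [k] of digit [e] is handled by this iteration; smaller values were handled earlier and
   stay beaten. *)
rewrite ltnS leq_eqVlt => /orP[/eqP f_e|lt_k] lead.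
  apply: (new2 f) => // c; rewrite ltnS leq_eqVlt => /orP[/eqP->|lt_c].
    by rewrite f_e /digit s1_k.
  by rewrite digit1 ?f_s.
by have := new1 f tau f_s f_lt lt_k lead => /mono2.
Qed.

(** Every solution is led by some choice and all choices are enumerated, so every feasible solution
    ends up beaten. An unset flag thus excludes feasible solutions. *)
Lemma runs_program : runs n (nest m L upd 0 (m * L)) (init I) (fun s =>
  if nmem s 1%N 0%N == 0%N then forall sigma, ~ feasible I sigma
  else exists2 sigma, feasible I sigma /\
         (forall tau, feasible I tau -> objective sigma <= objective tau)
       & forall (i : 'I_m) (j : 'I_n), nmem s 2%N (i * n + j)%N = sigma i j).
Proof.
have inp : inputs (init I) by [].
apply: runs_conseq (runs_nest (add0n _) inp _ _) _ => // s' _ [sol _ new].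
have {}new tau : beaten tau s'.
  by have [f f_lt lead] := leads_exists lt_Ln tau; apply: (new f).
case: eqP => [no_flag sigma /new[]|/eqP]; first by rewrite no_flag.
rewrite -lt0n => /sol[sigma [feas best] out]; exists sigma => //; split=> // tau.
by case/new => _; rewrite best.
Qed.

End Correctness.

(** * Running time, and the two objectives as instances *)

(** [op] stands for sum or maximum. The program is assembled from [m], [K] and [upd] before [n] and
    the instance are given, so one program and one constant serve all of them. *)
Lemma solvable_by_enumeration (R : realFieldType) (K m : nat)
    (op : SemiGroup.com_law R) (upd : cmd) :
    (0 < K)%N -> (0 < m)%N ->
    (forall a, nwr upd a = false) -> (forall a, rwr upd a -> a = 7%N) ->
    depth upd = 0%N ->
    (forall n (s : state R), runs n upd s
      (fun s' => rmem s' 7%N 0%N = op (rmem s 7%N 0%N) (rmem s 6%N 0%N))) ->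
  solvable_in_bigO
    (fun n (I : instance R n m) sigma => \big[op/0]_(j < n) energy I sigma j)
    (fun n I => [/\ (K <= n)%N, valid I & constant_from K I])
    (fun n => m * n ^ (K * m + 1))%N.
Proof.
case: K => // L _ m_gt0 nwr_upd rwr_upd depth_upd runs_upd.
set P := nest m L upd 0 (m * L).
have [C P_cost] := tcost_bound P; exists P, C => n I [lt_Ln _ const].
have [t [s [E T out]]] :=
  runs_program nwr_upd rwr_upd (runs_upd n) lt_Ln const.
exists t, s; split=> //.
have n_gt0 : (0 < n)%N by apply: leq_ltn_trans lt_Ln.
apply: leq_trans T _; apply: leq_trans (P_cost n n_gt0) _.
rewrite leq_mul2l; apply/orP; right; apply: leq_trans (leq_pmull _ m_gt0).
(* The [m * L] enumeration loops surround one level of linear loops, and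
   [m * L + 1 <= K * m + 1]. *)
rewrite leq_pexp2l // (leq_trans (depth_nest _ _ depth_upd _ _)) //.
by rewrite addn1 ltnS mulnC leq_mul2r leqnSn orbT.
Qed.

Theorem proposition21 (R : realFieldType) (K m : nat)
    (K_gt0 : (0 < K)%N) (m_gt0 : (0 < m)%N) :
  let admissible (n : nat) (I : instance R n m) :=
    [/\ (K <= n)%N, valid I & constant_from K I] in
  let T (n : nat) := (m * n ^ (K * m + 1))%N in
  solvable_in_bigO (fun n => @total_energy R n m) admissible T /\
  solvable_in_bigO (fun n => @max_energy R n m) admissible T.
Proof.
split.
  apply: (@solvable_by_enumeration R K m +%R (rset 7 (RAdd (rv 7) (rv 6)))) => //.
    by move=> a /eqP.
  by move=> n s; apply: runs_rput.
apply: (@solvable_by_enumeration R K m Num.max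
  (If (RLe (rv 7) (rv 6)) (rset 7 (rv 6)) Skip)) => //.
  by move=> a; rewrite /= orbF => /eqP.
move=> n s; apply: runs_if => /= [le_76|].
  by apply: runs_rput; rewrite /= max_r.
by rewrite -ltNge => lt_67; apply: runs_skip; rewrite max_l // ltW.
Qed.
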